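(* Let $G$ be a directed graph (loops allowed) on vertex set $\{v_1,\dots,v_N\}$ with weighted adjacency matrix $\mathsf{W}=(\omega_{ij})$. For all $i,j\in\{1,\dots,N\}$ and every hike $h\in\mathcal H$, $$\mu_{ij}(h)=(\mu * f_{ij})(h)=\sum_{d\mid h}\mu(d)\,f_{ij}\Big(\frac hd\Big).$$
   Context: The $\omega_{ij}$ are formal variables ($\omega_{ij}=0$ if there is no edge from $v_i$ to $v_j$). A walk of length $\ell$ from $v_i$ to $v_j$ is a succession of contiguous edges $\omega_{i i_1}\omega_{i_1i_2}\cdots\omega_{i_{\ell-1}j}$, identified with the monomial of its edges (two walks are equal if they have the same edges with multiplicity); $1$ is the walk of length $0$ from $v_i$ to $v_i$. A walk is closed if $i=j$; it is simple if its vertices are pairwise distinct except possibly $i=j$ for closed walks (loops and backtracks $\omega_{ij}\omega_{ji}$ are simple cycles). A hike from $v_i$ to $v_j$ is a monomial that is the product of a simple walk from $v_i$ to $v_j$ and simple cycles; $\mathcal H$ is the set of all hikes. A closed hike is a product of simple cycles (including the empty product $1$); $\mathcal C$ is the set of closed hikes. $V(h)$ is the set of vertices crossed by $h$, $n(h)$ the number of connected components of the subgraph formed by the edges of $h$. A hike is self-avoiding if it crosses no vertex twice (it is a product of pairwise vertex-disjoint simple cycles and, if open, one simple path disjoint from them); $\mathcal S_{ij}$ is the set of self-avoiding hikes from $v_i$ to $v_j$. For $d\in\mathcal C$ and $h\in\mathcal H$, $d\mid h$ means $h=dh'$ for some $h'\in\mathcal H$ (only closed divisors are considered, including $1$ and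 possibly $h$ itself). $\mu:\mathcal C\to\mathbb R$: $\mu(1)=1$, $\mu(c)=(-1)^{n(c)}$ if $c$ is self-avoiding, $0$ otherwise. $\mu_{ij}:\mathcal H\to\mathbb R$: $\mu_{ij}(h)=(-1)^{n(h)+1}$ if $i\ne j$ and $h\in\mathcal S_{ij}$; $\mu_{ij}(h)=(-1)^{n(h)}$ if $i=j$, $h$ is a self-avoiding closed hike with $v_i\notin V(h)$; $0$ otherwise. $f_{ij}:\mathcal H\to\mathbb R$: for a walk $w$ of length $\ell$, $f_{ij}(w)$ is the number of ways to write $w$ as a succession of contiguous edges starting at $v_i$ and ending at $v_j$ (equivalently, the coefficient of the monomial $w$ in the $(i,j)$ entry of $\mathsf{W}^\ell$; $f_{ij}(1)=1$ if $i=j$ and $0$ otherwise), and $f_{ij}(h)=0$ if $h$ is not connected. *)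

(* Defs.v *)
From HB Require Import structures.
From mathcomp Require Import all_boot all_order all_algebra.
From mathcomp Require Import boolp classical_sets cardinality fsbigop reals.
From mathcomp Require Import finmap monalg.

Set Implicit Arguments.
Unset Strict Implicit.
Unset Printing Implicit Defensive.

Import GRing.Theory.
Local Open Scope ring_scope.

(* A digraph on {v_1, ..., v_N} is given by its edge relation [E : rel 'I_N],
   and the variable omega_ij is [ucm (i, j)].  The monomials below range over
   all pairs (i, j); only walks are required to use edges of [E], so that no
   hike involves a variable omega_ij with (i, j) not an edge. *)
Definition monom (N : nat) := {cmonom ('I_N * 'I_N)%type}.

Section Hikes.
Variables (N : nat) (E : rel 'I_N).
Implicit Types (i j : 'I_N) (s : seq 'I_N) (c d h w : monom N).

(* The vertex sequence of a walk of length l is v_i :: s with size s = l;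
   [s = [::]] gives the walk of length 0 from v_i to v_i. *)
Definition is_walk i j s : bool := path E i s && (last i s == j).

(* The truncating [zip] pairs each vertex of i :: s with its successor. *)
Definition walk_monom i s : monom N :=
  \big[mmul/mone]_(e <- zip (i :: s) s) ucm e.

(* For a closed walk i = last i s, hence s lists each visited vertex once. *)
Definition is_simple_walk i j s : bool :=
  is_walk i j s && (if i == j then uniq s else uniq (i :: s)).

Definition simple_walk i j w : Prop :=
  exists2 s, is_simple_walk i j s & w = walk_monom i s.

Definition simple_cycle c : Prop :=
  exists i s, [/\ s != [::], is_simple_walk i i s & c = walk_monom i s].

Definition monom_prod (cs : seq (monom N)) : monom N :=
  \big[mmul/mone]_(c <- cs) c.

Definition hike_from_to i j h : Prop :=
  exists w cs, [/\ simple_walk i j w,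
    (forall c, c \in cs -> simple_cycle c) & h = mmul w (monom_prod cs)].

Definition hike h : Prop := exists i j, hike_from_to i j h.

Definition closed_hike h : Prop :=
  exists2 cs, (forall c, c \in cs -> simple_cycle c) & h = monom_prod cs.

Definition adjacent h : rel 'I_N :=
  fun u v => (0 < h (u, v))%N || (0 < h (v, u))%N.

Definition vertices h : {set 'I_N} := [set v | [exists u, adjacent h u v]].

Definition ncomp h : nat := n_comp (adjacent h) (vertices h).

Definition vertex_disjoint (cs : seq (monom N)) : bool :=
  pairwise (fun c d => [disjoint vertices c & vertices d]) cs.

Definition self_avoiding_closed h : Prop :=
  exists cs, [/\ (forall c, c \in cs -> simple_cycle c),
    vertex_disjoint cs & h = monom_prod cs].

Definition self_avoiding_from_to i j h : Prop :=
  exists w cs, [/\ simple_walk i j w,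
    (forall c, c \in cs -> simple_cycle c),
    vertex_disjoint (w :: cs) & h = mmul w (monom_prod cs)].

Definition closed_divides d h : Prop :=
  closed_hike d /\ exists2 h', hike h' & h = mmul d h'.

Definition closed_divisors h : set (monom N) :=
  [set d | closed_divides d h]%classic.

(* Sums over [closed_divisors h] are genuine finite sums. *)
Lemma finite_closed_divisors h : finite_set (closed_divisors h).
Proof.
pose B := (\sum_(e <- finsupp h) h e)%N.
pose G (F : {ffun 'I_N * 'I_N -> 'I_B.+1}) : monom N :=
  [cmonom (F e : nat) | e in finsupp h]%M.
apply: (@sub_finite_set _ _ (G @` setT)%classic); last first.
  by apply: finite_image; exact: finite_finset.
move=> d [_ [h' _ hE]].
have dh e : (d e <= h e)%N by rewrite hE mulcmE leq_addr.
exists [ffun e => inord (d e)] => //.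
apply/eqP/cmP => e; rewrite cmE fsfunE ffunE.
case: ifPn => [eh|]; last first.
  by rewrite memNfinsupp => /eqP h0; have := dh e; rewrite h0 leqn0 => /eqP.
rewrite inordK // ltnS (leq_trans (dh e)) //.
by rewrite /B (big_rem e) //= leq_addr.
Qed.

Variable R : realType.

Definition mu c : R :=
  if `[< self_avoiding_closed c >] then (-1) ^+ ncomp c else 0.

Definition mu_ij i j h : R :=
  if i != j then
    if `[< self_avoiding_from_to i j h >] then (-1) ^+ (ncomp h).+1 else 0
  else
    if `[< self_avoiding_closed h >] && (i \notin vertices h)
    then (-1) ^+ ncomp h else 0.

(* The number of walks from v_i to v_j, as vertex sequences, with monomial h;
   it vanishes when h is not connected, no walk having such a monomial. *)
Definition f_ij i j h : R :=
  #|[pred s : (mdeg h).-tuple 'I_N | is_walk i j s & walk_monom i s == h]|%:R.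

End Hikes.

Arguments mu {N} E R c.
Arguments mu_ij {N} E R i j h.
Arguments f_ij {N} E R i j h.

(* Main.v *)
Require Import Defs.
From mathcomp Require Import boolp classical_sets functions fsbigop reals.
From mathcomp Require Import finmap monalg.
From mathcomp Require Import all_boot all_order all_algebra fingroup perm.

Set Implicit Arguments.
Unset Strict Implicit.
Unset Printing Implicit Defensive.

Import GRing.Theory.
Local Open Scope ring_scope.

(* Let W be the matrix of the variables omega_ij of the edges, over the algebra
   of monomials. Expanding the determinant over permutations, the coefficient of
   d in det (1 - W) is mu d: the self-avoiding closed hikes are the products of
   the omega_(k, t k) for k in T, where t is a permutation supported on T, and the
   sign of t times (-1)^|T| is (-1) to the number of cycles of t in T. Adding the
   edge (j, i), whose variable occurs in row j only, changes det (1 - W) by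
   - adj(1 - W)_ij omega_ji, so the coefficient of h in adj(1 - W)_ij is - mu of
   h omega_ji in the enlarged graph, which is mu_ij h. The theorem is then the
   coefficient of h in adj(1 - W) (1 - W^L) = det (1 - W) (1 + ... + W^(L-1)) for
   L > deg h; that only divisors d with h/d a hike contribute is loop erasure. *)

(** * Vertex degrees of monomials, and monomials of partial permutations *)

Section Degrees.
Variable N : nat.
Implicit Types (E : rel 'I_N) (h c d w : monom N) (s : seq 'I_N).
Implicit Types (i j u v x : 'I_N) (t : {perm 'I_N}) (T : {set 'I_N}).

Definition outdeg h u := (\sum_v h (u, v))%N.
Definition indeg h v := (\sum_u h (u, v))%N.

Lemma monom_ext c d : (forall u v, c (u, v) = d (u, v)) -> c = d.
Proof. by move=> cd; apply/eqP/cmP => -[u v]; apply: cd. Qed.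

Lemma outdegM c d u : outdeg (mmul c d) u = (outdeg c u + outdeg d u)%N.
Proof. by rewrite /outdeg -big_split; apply: eq_bigr => v _; rewrite cmM. Qed.

Lemma indegM c d v : indeg (mmul c d) v = (indeg c v + indeg d v)%N.
Proof. by rewrite /indeg -big_split; apply: eq_bigr => u _; rewrite cmM. Qed.

Lemma outdeg1 u : outdeg mone u = 0%N.
Proof. by rewrite /outdeg big1 // => v _; rewrite cm1. Qed.

Lemma indeg1 u : indeg mone u = 0%N.
Proof. by rewrite /indeg big1 // => v _; rewrite cm1. Qed.

Lemma outdegU i j u : outdeg (ucm (i, j)) u = (i == u).
Proof.
rewrite /outdeg (bigD1 j) //= cmU xpair_eqE eqxx andbT big1 ?addn0 // => v vj.
by rewrite cmU xpair_eqE [j == v]eq_sym (negPf vj) andbF.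
Qed.

Lemma indegU i j v : indeg (ucm (i, j)) v = (j == v).
Proof.
rewrite /indeg (bigD1 i) //= cmU xpair_eqE eqxx big1 ?addn0 // => u ui.
by rewrite cmU xpair_eqE [i == u]eq_sym (negPf ui).
Qed.

Lemma leq_outdeg h u v : (h (u, v) <= outdeg h u)%N.
Proof. by rewrite /outdeg (bigD1 v) //= leq_addr. Qed.

Lemma leq_indeg h u v : (h (u, v) <= indeg h v)%N.
Proof. by rewrite /indeg (bigD1 u) //= leq_addr. Qed.

Lemma outdeg_gt0P h u : reflect (exists v, (0 < h (u, v))%N) (0 < outdeg h u)%N.
Proof.
apply: (iffP idP) => [|[v /leq_trans]]; last by apply; apply: leq_outdeg.
rewrite lt0n sum_nat_eq0 negb_forall => /existsP[v].
by rewrite /= -lt0n; exists v.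
Qed.

Lemma indeg_gt0P h v : reflect (exists u, (0 < h (u, v))%N) (0 < indeg h v)%N.
Proof.
apply: (iffP idP) => [|[u /leq_trans]]; last by apply; apply: leq_indeg.
rewrite lt0n sum_nat_eq0 negb_forall => /existsP[u].
by rewrite /= -lt0n; exists u.
Qed.

Lemma mem_vertices h u :
  (u \in vertices h) = (0 < outdeg h u)%N || (0 < indeg h u)%N.
Proof.
rewrite inE; apply/existsP/orP.
  case=> v /orP[h0|h0]; first by right; apply/indeg_gt0P; exists v.
  by left; apply/outdeg_gt0P; exists v.
by case=> [/outdeg_gt0P|/indeg_gt0P] [v hv]; exists v;
  rewrite /adjacent hv ?orbT.
Qed.

Lemma verticesM c d : vertices (mmul c d) = vertices c :|: vertices d.
Proof.
apply/setP => u; rewrite in_setU !mem_vertices outdegM indegM !addn_gt0.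
by rewrite orbACA.
Qed.

Lemma vertices_prod cs u :
  (u \in vertices (monom_prod cs)) = has (fun c => u \in vertices c) cs.
Proof.
rewrite /monom_prod; elim: cs => [|c cs IHcs] /=.
  by rewrite big_nil mem_vertices outdeg1 indeg1.
by rewrite big_cons verticesM in_setU IHcs.
Qed.

Lemma disjoint_vertices_prod c cs :
  [disjoint vertices c & vertices (monom_prod cs)] =
    all (fun d => [disjoint vertices c & vertices d]) cs.
Proof.
apply/idP/allP => [dis d dcs|dis].
  apply: disjointWr dis; apply/subsetP => u ud; rewrite vertices_prod.
  by apply/hasP; exists d.
rewrite disjoint_subset; apply/subsetP => u uc; rewrite inE vertices_prod.
apply/hasPn => d dcs; apply: contraL uc => ud.
by have := dis d dcs; rewrite disjoint_sym => /disjointFr ->.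
Qed.

Lemma walk_monom_nil i : walk_monom i [::] = mone.
Proof. by rewrite /walk_monom big_nil. Qed.

Lemma walk_monom_cons i x s :
  walk_monom i (x :: s) = mmul (ucm (i, x)) (walk_monom x s).
Proof. by rewrite /walk_monom /= big_cons. Qed.

Lemma walk_monom_cat i s1 s2 :
  walk_monom i (s1 ++ s2) = mmul (walk_monom i s1) (walk_monom (last i s1) s2).
Proof.
elim: s1 i => [|x s1 IHs] i /=; first by rewrite walk_monom_nil mul1m.
by rewrite !walk_monom_cons IHs mulmA.
Qed.

Lemma mdeg_walk i s : mdeg (walk_monom i s) = size s.
Proof.
elim: s i => [|x s IHs] i; first by rewrite walk_monom_nil mdeg1.
by rewrite walk_monom_cons mdegM mdegU IHs.
Qed.

(** Each listed vertex is left once, except the last occurrence of the end vertex; the correction is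
    added on the left to avoid a truncated subtraction. *)
Lemma outdeg_walk i s u :
  (outdeg (walk_monom i s) u + (last i s == u))%N = count_mem u (i :: s).
Proof.
elim: s i => [|x s IHs] i; first by rewrite walk_monom_nil outdeg1 /= addn0.
by rewrite walk_monom_cons outdegM outdegU -addnA IHs.
Qed.

Lemma indeg_walk i s v : indeg (walk_monom i s) v = count_mem v s.
Proof.
elim: s i => [|x s IHs] i; first by rewrite walk_monom_nil indeg1.
by rewrite walk_monom_cons indegM indegU IHs.
Qed.

Lemma walk_monom_edge E i s u v :
  path E i s -> (0 < walk_monom i s (u, v))%N -> E u v.
Proof.
elim: s i => [|x s IHs] i /=; first by rewrite walk_monom_nil cm1.
case/andP=> Eix /IHs{}IHs; rewrite walk_monom_cons cmM cmU addn_gt0.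
by case/orP=> [|/IHs//]; case: eqP => // -[<- <-].
Qed.

(** Self-avoiding closed hikes described by degrees alone: the edges of [h] form the graph of a
    permutation of the vertices it crosses. *)
Definition partial_perm E h :=
  (forall u v, (0 < h (u, v))%N -> E u v) /\
  (forall u, outdeg h u = indeg h u /\ (outdeg h u <= 1)%N).

Lemma partial_permS E E' h :
  subrel E E' -> partial_perm E h -> partial_perm E' h.
Proof. by move=> sEE' [hE hd]; split=> // u v /hE /sEE'. Qed.

Lemma partial_permM E c d : partial_perm E c -> partial_perm E d ->
  [disjoint vertices c & vertices d] -> partial_perm E (mmul c d).
Proof.
move=> [cE cd] [dE dd] dis; split=> u.
  by move=> v; rewrite cmM addn_gt0 => /orP[/cE|/dE].
rewrite outdegM indegM; have [<- c1] := cd u; have [<- d1] := dd u.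
split=> //; case: (posnP (outdeg c u)) => [-> //|c0].
have uc : u \in vertices c by rewrite mem_vertices c0.
have := disjointFr dis uc; rewrite mem_vertices.
by case: (posnP (outdeg d u)) => // ->; rewrite addn0.
Qed.

Lemma partial_perm1 E : partial_perm E mone.
Proof.
by split=> u => [v|]; rewrite ?outdeg1 ?indeg1 ?cm1.
Qed.

Lemma simple_cycle_partial_perm E c : simple_cycle E c -> partial_perm E c.
Proof.
case=> i [s [_ /andP[/andP[pis /eqP lis]]]]; rewrite eqxx => us ->.
split=> u; first by move=> v; apply: walk_monom_edge.
have := outdeg_walk i s u; rewrite lis /= addnC indeg_walk => /addnI ->.
by rewrite count_uniq_mem ?leq_b1.
Qed.

Lemma self_avoiding_closed_partial_perm E h :
  self_avoiding_closed E h -> partial_perm E h.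
Proof.
case=> cs [csE dis ->] {h}; elim: cs csE dis => [|c cs IHcs] csE.
  by rewrite /monom_prod big_nil => _; apply: partial_perm1.
rewrite /vertex_disjoint /= -disjoint_vertices_prod => /andP[dc /IHcs pcs].
rewrite /monom_prod big_cons; apply: partial_permM => //.
  by apply: simple_cycle_partial_perm; apply: csE; rewrite mem_head.
by apply: pcs => d dcs; apply: csE; rewrite inE dcs orbT.
Qed.

(** A fixed point of [t] gives a loop if it lies in [T] and nothing otherwise, so [t] alone would
    not determine the monomial. *)
Definition perm_monom T t : monom N := \big[mmul/mone]_(k in T) ucm (k, t k).

Lemma perm_monomE T t u v : perm_monom T t (u, v) = (u \in T) && (t u == v).
Proof.
have -> : perm_monom T t (u, v) = (\sum_(k in T) ucm (k, t k) (u, v))%N.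
  by rewrite /perm_monom; apply: (big_morph (fun h : monom N => h (u, v)));
    [move=> c d; apply: cmM | apply: cm1].
case: (boolP (u \in T)) => [uT|uT] /=; last first.
  apply: big1 => k kT; rewrite cmU xpair_eqE.
  by case: eqP => //= ku; move: uT; rewrite -ku kT.
rewrite (bigD1 u) //= cmU xpair_eqE eqxx /= big1 ?addn0 // => k /andP[_ ku].
by rewrite cmU xpair_eqE (negPf ku).
Qed.

Lemma outdeg_perm T t u : outdeg (perm_monom T t) u = (u \in T).
Proof.
rewrite /outdeg (bigD1 (t u)) //= perm_monomE eqxx andbT big1 ?addn0 // => v.
by rewrite perm_monomE eq_sym => /negPf ->; rewrite andbF.
Qed.

Lemma indeg_perm T t v : indeg (perm_monom T t) v = ((t^-1)%g v \in T).
Proof.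
rewrite /indeg (bigD1 ((t^-1)%g v)) //= perm_monomE permKV eqxx andbT.
rewrite big1 ?addn0 // => u; rewrite perm_monomE.
by rewrite (can2_eq (permK t) (permKV t)) => /negPf ->; rewrite andbF.
Qed.

(** As [t] is injective and [T] finite, the inclusion of [t @: T] in [T] is an equality, which makes
    in-degrees and out-degrees agree. *)
Lemma partial_perm_perm E T t : {homo t : k / k \in T} ->
  {in T, forall k, E k (t k)} -> partial_perm E (perm_monom T t).
Proof.
move=> tT ET; split=> u.
  by move=> v; rewrite perm_monomE lt0b => /andP[uT /eqP <-]; apply: ET.
rewrite outdeg_perm indeg_perm leq_b1; split=> //; congr nat_of_bool.
have st : t @: T \subset T by apply/subsetP => _ /imsetP[k kT ->]; apply: tT.
have et : t @: T = T.
  by apply/eqP; rewrite eqEcard st card_imset; [apply: leqnn | apply: perm_inj].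
by rewrite -{1}et -{1}[u](permKV t) (mem_imset _ _ (@perm_inj _ t)).
Qed.

Lemma vertices_perm T t : {homo t : k / k \in T} ->
  vertices (perm_monom T t) = T.
Proof.
move=> tT.
(* In the complete graph the edge condition is trivial, and the equality of degrees remains. *)
have [_ h] := @partial_perm_perm (fun _ _ => true) T t tT (fun _ _ => erefl).
apply/setP => u; rewrite mem_vertices; have [<- _] := h u.
by rewrite orbb outdeg_perm lt0b.
Qed.

(** [t] sends a vertex to its only successor, and fixes it if there is none. It is injective because
    in-degrees are at most 1, and vertices without successor have no predecessor either. *)
Lemma partial_permP E h : partial_perm E h ->
  exists T t,
    [/\ perm_on T t, {in T, forall k, E k (t k)} & h = perm_monom T t].
Proof.
case=> hE hd.
pose f u := odflt u [pick v | 0 < h (u, v)]%N.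
have fP u : (0 < outdeg h u)%N -> (0 < h (u, f u))%N.
  case/outdeg_gt0P => v hv.
  by rewrite /f; case: pickP => [//|/(_ v)]; rewrite hv.
have f0 u : (outdeg h u = 0)%N -> f u = u.
  move=> h0; rewrite /f; case: pickP => // v hv.
  by have := leq_trans hv (leq_outdeg h u v); rewrite h0.
have inj : injective f.
  have in1 u u' v : (0 < h (u, v))%N -> (0 < h (u', v))%N -> u = u'.
    move=> hu hu'; apply/eqP; apply: contraT => uu'.
    have [eqd] := hd v.
    rewrite eqd /indeg (bigD1 u) //= (bigD1 u') 1?eq_sym //=.
    case: (h (u, v)) hu => // a _; case: (h (u', v)) hu' => // b _.
    by rewrite addSn addnS.
  have aux u u' : (0 < outdeg h u)%N -> (outdeg h u' = 0)%N -> f u != f u'.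
    move=> hu hu'; rewrite (f0 _ hu'); apply: contraTneq (fP _ hu) => ->.
    rewrite -eqn0Ngt -leqn0; have [eqd _] := hd u'.
    by apply: leq_trans (leq_indeg _ _ _) _; rewrite -eqd hu'.
  move=> u u' ff; case: (posnP (outdeg h u)) => [hu|hu];
    case: (posnP (outdeg h u')) => [hu'|hu'].
  - by rewrite -(f0 _ hu) ff f0.
  - by have := aux _ _ hu' hu; rewrite ff eqxx.
  - by have := aux _ _ hu hu'; rewrite ff eqxx.
  - by apply: (in1 _ _ (f u)); [apply: fP | rewrite ff; apply: fP].
exists [set u | 0 < outdeg h u]%N, (perm inj); split.
- apply/subsetP => u; rewrite !inE permE; apply: contraR.
  by rewrite -eqn0Ngt => /eqP /f0 ->.
- by move=> u; rewrite inE permE => /fP /hE.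
- apply: monom_ext => u v; rewrite perm_monomE inE permE.
  case: (posnP (outdeg h u)) => [h0|h0] /=.
    by apply/eqP; move: (leq_outdeg h u v); rewrite h0 leqn0.
  have [_ out1] := hd u; have fu := fP u h0.
  move: out1; rewrite /outdeg (bigD1 (f u)) //= => out1.
  have [<-|nv] := eqVneq (f u) v.
    by apply/eqP; rewrite eqn_leq fu andbT (leq_trans (leq_addr _ _) out1).
  (* The edge to [f u] already exhausts the out-degree:
     [h (u, f u) + h (u, v) <= 1 <= h (u, f u)]. *)
  apply/eqP; rewrite -leqn0 -(leq_add2l (h (u, f u))) addn0.
  apply: leq_trans fu; apply: leq_trans out1.
  by rewrite leq_add2l (bigD1 v) 1?eq_sym //= leq_addr.
Qed.

End Degrees.

(** * Cycle decomposition and self-avoiding hikes *)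

Section Cycles.
Variable N : nat.
Implicit Types (E : rel 'I_N) (h c d w : monom N) (s : seq 'I_N).
Implicit Types (i j u v x : 'I_N) (t : {perm 'I_N}) (T : {set 'I_N}).

Lemma walk_traject t x n :
  walk_monom x (traject t (t x) n) =
    \big[mmul/mone]_(k <- traject t x n) ucm (k, t k).
Proof.
elim: n x => [|n IHn] x /=; first by rewrite walk_monom_nil big_nil.
by rewrite walk_monom_cons big_cons IHn.
Qed.

Lemma path_traject E t x n :
  {in traject t x n, forall k, E k (t k)} -> path E x (traject t (t x) n).
Proof.
elim: n x => //= n IHn x Et; rewrite Et ?mem_head // IHn // => k kn.
by rewrite Et // inE kn orbT.
Qed.

Lemma perm_monom_orbit t x :
  perm_monom [set y in orbit t x] t =
    \big[mmul/mone]_(k <- orbit t x) ucm (k, t k).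
Proof.
rewrite /perm_monom (big_uniq _ (orbit_uniq t x)).
by apply: eq_bigl => k; rewrite inE.
Qed.

Lemma perm_monomD T (O : {set _}) t : O \subset T ->
  perm_monom T t = mmul (perm_monom O t) (perm_monom (T :\: O) t).
Proof. by move=> /setIidPr OT; rewrite /perm_monom (big_setID O) OT. Qed.

Lemma orbit_sub T t x : {homo t : k / k \in T} -> x \in T ->
  [set y in orbit t x] \subset T.
Proof.
move=> tT xT; apply/subsetP => y; rewrite inE => /trajectP[n _ ->].
by elim: n => //= n; apply: tT.
Qed.

Lemma homo_setD_orbit T t x : {homo t : k / k \in T} ->
  {homo t : k / k \in T :\: [set y in orbit t x]}.
Proof.
move=> tT k; rewrite !inE -!fconnect_orbit -(same_fconnect1_r (@perm_inj _ t)).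
by case/andP=> -> /tT.
Qed.

Lemma card_setD_orbit T t x : x \in T ->
  (#|T :\: [set y in orbit t x]| < #|T|)%N.
Proof.
move=> xT; apply/proper_card/properP; split; first exact: subsetDl.
by exists x; rewrite // !inE in_orbit.
Qed.

Lemma disjoint_setD (A B : {set 'I_N}) : [disjoint A & B :\: A].
Proof. by rewrite disjoints_subset setCD subsetUr. Qed.

(** Strong induction on [#|T|], removing the orbit of some [x] as one simple cycle. Stability of [T]
    is assumed instead of [perm_on] because [t] is kept while [T] shrinks. *)
Lemma perm_self_avoiding_closed E T t : {homo t : k / k \in T} ->
  {in T, forall k, E k (t k)} -> self_avoiding_closed E (perm_monom T t).
Proof.
have [n] := ubnP #|T|; elim: n T => // n IHn T; rewrite ltnS => Tn tT ET.
have [->|[x xT]] := set_0Vmem T.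
  by exists [::]; split=> //; rewrite /perm_monom /monom_prod big_set0 big_nil.
have OT := orbit_sub tT xT; have tD := @homo_setD_orbit T t x tT.
have := card_setD_orbit t xT; set O := [set y in orbit t x] in OT tD *.
move=> /leq_trans/(_ Tn) Dn.
have [|cs [csE dis csD]] := IHn _ Dn tD.
  by move=> k; rewrite inE => /andP[_ /ET].
exists (perm_monom O t :: cs); split.
- move=> c; rewrite inE => /predU1P[->|/csE //].
  (* A walk does not list its initial vertex: the sequence begins at [t x] and ends at [x]. *)
  exists x, (traject t (t x) (fingraph.order t x)); split.
  + by rewrite -orderSpred.
  + rewrite /is_simple_walk /is_walk eqxx path_traject; last first.
      by move=> k kO; apply/ET/(subsetP OT); rewrite inE.
    rewrite last_traject (iter_order (@perm_inj _ t)) eqxx /=.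
    (* Since [t x] has the same order as [x], the sequence is the orbit of [t x]. *)
    rewrite -(order_id_cycle (cycle_orbit (@perm_inj _ t) x)).
    exact: orbit_uniq.
  + by rewrite walk_traject perm_monom_orbit.
- rewrite /vertex_disjoint /= -disjoint_vertices_prod -csD (vertices_perm tD).
  rewrite vertices_perm ?disjoint_setD // => k; rewrite !inE -!fconnect_orbit.
  by rewrite -(same_fconnect1_r (@perm_inj _ t)).
- by rewrite /monom_prod big_cons -[X in mmul _ X]csD -perm_monomD.
Qed.

Lemma perm_on_homo T t : perm_on T t -> {homo t : k / k \in T}.
Proof. by move=> tT k; rewrite (perm_closed _ tT). Qed.

Lemma self_avoiding_closedP E h : self_avoiding_closed E h <-> partial_perm E h.
Proof.
split=> [|/partial_permP[T [t [tT ET ->]]]].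
  exact: self_avoiding_closed_partial_perm.
exact: (perm_self_avoiding_closed (perm_on_homo tT) ET).
Qed.

(** The added edge goes from [j] back to [i], so as to close paths from [i] to [j]; it may already
    belong to [E]. *)
Definition add_edge E j i : rel 'I_N :=
  fun u v => E u v || ((u == j) && (v == i)).

Lemma subrel_add_edge E j i : subrel E (add_edge E j i).
Proof. by move=> u v; rewrite /add_edge => ->. Qed.

Lemma mmul_ucm_inj c d (e : 'I_N * 'I_N) :
  mmul c (ucm e) = mmul d (ucm e) -> c = d.
Proof.
move=> cd; apply/eqP/cmP => k; apply/eqP.
by rewrite -(eqn_add2r (ucm e k)) -!cmM cd.
Qed.

(** The edge from [j] to [i] closes the simple path into a simple cycle; conversely, removing it
    opens the cycle through [j]. *)
Lemma self_avoiding_from_toP E i j h : i != j ->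
  self_avoiding_from_to E i j h <->
    partial_perm (add_edge E j i) (mmul h (ucm (j, i))).
Proof.
move=> ij; split=> [[w [cs [[s]]]]|].
  rewrite /is_simple_walk (negPf ij) => /andP[/andP[pis /eqP lis]] us -> csE.
  rewrite /vertex_disjoint /= -disjoint_vertices_prod => /andP[dis discs] ->.
  rewrite -mulmA [mmul (monom_prod _) _]mulmC mulmA.
  have outs u := outdeg_walk i s u; have ins u := indeg_walk i s u.
  apply: partial_permM.
  - split=> u.
      move=> v; rewrite cmM cmU addn_gt0 => /orP[/(walk_monom_edge pis)|].
        exact: subrel_add_edge.
      rewrite lt0b xpair_eqE => /andP[/eqP <- /eqP <-].
      by rewrite /add_edge !eqxx orbT.
    rewrite outdegM indegM outdegU indegU -lis outs /= ins addnC.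
    split=> //; have := count_uniq_mem u us.
    by rewrite /= addnC => ->; apply: leq_b1.
  - apply: partial_permS (@subrel_add_edge E j i) _.
    by apply: self_avoiding_closed_partial_perm; exists cs.
  (* The closing edge meets no new vertex: as [i != j], the path [w] enters [j] and leaves [i]. *)
  - apply: disjointWl dis; rewrite verticesM subUset subxx /=.
    apply/subsetP => u; rewrite mem_vertices outdegU indegU !lt0b.
    have jns : j \in s.
      case: (s) lis => [|y s' <-] /= => [eij|]; last exact: mem_last.
      by rewrite eij eqxx in ij.
    rewrite mem_vertices ins => /orP[] /eqP <-.
      by rewrite -has_count has_pred1 jns orbT.
    have := outs i; rewrite lis eq_sym (negPf ij) addn0 => ->.
    by rewrite /= eqxx.
case/partial_permP => T [t [tT ET eqh]].
have: (0 < mmul h (ucm (j, i)) (j, i))%N by rewrite cmM cmUU addn1.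
rewrite eqh perm_monomE lt0b => /andP[jT /eqP tj].
have {}tT := perm_on_homo tT.
have iT : i \in T by rewrite -tj tT.
have OT := orbit_sub tT iT; have tD := @homo_setD_orbit T t i tT.
set O := [set y in orbit t i] in OT tD *.
have tO : {homo t : k / k \in O}.
  move=> k; rewrite !inE -!fconnect_orbit.
  by rewrite -(same_fconnect1_r (@perm_inj _ t)).
(* As [t j = i], the orbit listed from [i] ends at [j]; one step less than the order gives the
   opened path. *)
have lasti : iter (fingraph.order t i).-1 t i = j.
  apply: (@perm_inj _ t); rewrite -iterS orderSpred iter_order ?tj //.
  exact: perm_inj.
have jO : j \in O by rewrite inE -fconnect_orbit -lasti fconnect_iter.
pose w := walk_monom i (traject t (t i) (fingraph.order t i).-1).
have wO : mmul w (ucm (j, i)) = perm_monom O t.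
  rewrite /w walk_traject perm_monom_orbit /orbit -orderSpred trajectSr.
  by rewrite big_rcons /= lasti tj.
(* The other cycles avoid [j], hence use edges of [E] only. *)
have [|cs [csE dis csD]] := @perm_self_avoiding_closed E _ t tD.
  move=> k; rewrite in_setD => /andP[kO /ET].
  by rewrite /add_edge; case: eqP kO => [->|]; rewrite ?jO ?orbF.
exists w, cs; split=> //.
- exists (traject t (t i) (fingraph.order t i).-1) => //.
  have uO := orbit_uniq t i; rewrite /orbit -orderSpred in uO.
  rewrite /is_simple_walk /is_walk last_traject lasti eqxx (negPf ij) !andbT.
  apply/andP; split=> //; apply: path_traject => k kO.
  have kj : k != j.
    apply: contraTneq uO => kj; rewrite trajectSr rcons_uniq lasti -kj kO //.
  have kT : k \in T.
    apply: (subsetP OT); rewrite inE /orbit -orderSpred trajectSr mem_rcons.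
    by rewrite inE kO orbT.
  by have := ET k kT; rewrite /add_edge (negPf kj) orbF.
- rewrite /vertex_disjoint /= -disjoint_vertices_prod -csD (vertices_perm tD).
  rewrite [pairwise _ _]dis andbT; apply: disjointWl (disjoint_setD O T).
  by rewrite -(vertices_perm tO) -wO verticesM subsetUl.
- apply: (@mmul_ucm_inj _ _ (j, i)); rewrite eqh (perm_monomD _ OT) -wO -csD.
  by rewrite -!mulmA [mmul _ (ucm _)]mulmC.
Qed.

(** * Connected components and signs *)

Lemma connect_adjacent_sym h : connect_sym (adjacent h).
Proof. by apply: sym_connect_sym => u v; rewrite /adjacent orbC. Qed.

Lemma adjacent_perm T t u v : adjacent (perm_monom T t) u v =
  (u \in T) && (t u == v) || (v \in T) && (t v == u).
Proof. by rewrite /adjacent !perm_monomE !lt0b. Qed.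

(** Reachability along a permutation is already symmetric, and a vertex outside [T] is both fixed
    and isolated. *)
Lemma connect_adjacent_perm T t : perm_on T t ->
  connect (adjacent (perm_monom T t)) =2 fconnect t.
Proof.
move=> tT x y; apply/idP/idP; apply: connect_sub => u v.
  rewrite adjacent_perm => /orP[] /andP[_ /eqP <-]; first exact: fconnect1.
  by rewrite fconnect_sym ?fconnect1 //; apply: perm_inj.
move=> /eqP <-; case: (boolP (u \in T)) => [uT|uT].
  by apply: connect1; rewrite adjacent_perm uT eqxx.
by rewrite (out_perm tT uT) connect0.
Qed.

Lemma ncomp_perm T t : perm_on T t -> ncomp (perm_monom T t) = fcard t T.
Proof.
move=> tT; rewrite /ncomp (eq_n_comp (connect_adjacent_perm tT)).
by rewrite (vertices_perm (perm_on_homo tT)).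
Qed.

(** Relates the cycles that define the sign of [t] to the roots counted by [n_comp]: each cycle
    contains exactly one root. *)
Lemma card_porbits t : #|porbits t| = fcard t predT.
Proof.
have e x y : (y \in porbit t x) = fconnect t x y.
  apply/porbitP/idP => [[n ->]|/iter_findex <-].
    by rewrite permX fconnect_iter.
  by exists (findex t x y); rewrite permX.
have st := fconnect_sym (@perm_inj _ t).
have -> : porbits t = [set porbit t x | x in froots t].
  apply/setP => X; apply/imsetP/imsetP => [] [x _ ->]; last by exists x.
  exists (froot t x); first exact: (roots_root st).
  by apply/eqP; rewrite eq_porbit_mem porbit_sym e connect_root.
rewrite card_in_imset; first by apply: eq_card => x; rewrite !inE andbT.
move=> x y /eqP rx /eqP ry /eqP; rewrite eq_porbit_mem porbit_sym e.
by rewrite -(root_connect st) rx ry => /eqP.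
Qed.

(* A permutation of [n] points with [c] cycles has sign [(-1) ^ (n - c)]; here
   the points outside of [T] are fixed. *)
Lemma sign_perm_monom (R : comPzRingType) T t : perm_on T t ->
  (-1) ^+ t * (-1) ^+ #|T| = (-1) ^+ ncomp (perm_monom T t) :> R.
Proof.
move=> tT; rewrite -[(-1) ^+ #|T|]signr_odd -[RHS]signr_odd -signr_addb.
congr (_ ^+ nat_of_bool _).
rewrite ncomp_perm // /odd_perm card_porbits (n_compC (mem T)) -(cardC (mem T)).
have -> : fcard t [predC (mem T)] = #|[predC (mem T)]|.
  apply: eq_card => x; rewrite !inE; case: (boolP (x \in T)) => xT.
    by rewrite andbF.
  rewrite andbT; apply/eqP; have := connect_root (frel t) x.
  move=> /iter_findex <-; elim: (findex _ _ _) => //= n ->.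
  exact: out_perm tT xT.
have -> : #|T| = #|mem T| by [].
rewrite !oddD.
move: (odd #|mem T|) (odd #|[predC mem T]|) (odd (fcard t (mem T))).
by do 3!case.
Qed.

(** If [i != j], the rest of the cycle through the added edge already connects [i] to [j] in [h]. If
    [i = j], the edge is a loop at a vertex that [h] does not cross, hence a new component. *)
Lemma ncomp_add_edge E i j h :
  partial_perm E (mmul h (ucm (j, i))) ->
  ncomp (mmul h (ucm (j, i))) = (ncomp h + (i == j))%N.
Proof.
move=> pp; have [T [t [tT _ eqh]]] := partial_permP pp.
have hle u v : adjacent h u v -> adjacent (mmul h (ucm (j, i))) u v.
  by rewrite /adjacent !cmM !addn_gt0 => /orP[] ->; rewrite ?orbT.
have: (0 < mmul h (ucm (j, i)) (j, i))%N by rewrite cmM cmUU addn1.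
rewrite eqh perm_monomE lt0b => /andP[jT /eqP tj].
have step u : u != j -> u \in T -> adjacent h u (t u).
  move=> uj uT; have := perm_monomE T t u (t u).
  rewrite -eqh uT eqxx cmM cmU xpair_eqE eq_sym (negPf uj) addn0 /adjacent.
  by move=> ->.
have tH := perm_on_homo tT.
have iT : i \in T by rewrite -tj tH.
have iterT n : iter n t i \in T by elim: n => //= n; apply: tH.
(* Iterating [t] from [i] follows edges of [h] up to [j], after which it restarts at [i]. *)
have cij : connect (adjacent h) i j.
  have /iter_findex <- : fconnect t i j.
    by rewrite -tj fconnect_sym ?fconnect1 //; apply: perm_inj.
  elim: (findex _ _ _) => [|n IHn]; first exact: connect0.
  have [e|uj] := eqVneq (iter n t i) j; first by rewrite iterS e tj connect0.
  by apply: connect_trans IHn _; apply/connect1/step.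
have symh := connect_adjacent_sym h.
have ct u : u \in T -> connect (adjacent h) u (t u).
  move=> uT; have [->|uj] := eqVneq u j; first by rewrite tj symh.
  by apply/connect1/step.
have cE : connect (adjacent (mmul h (ucm (j, i)))) =2 connect (adjacent h).
  move=> x y; apply/idP/idP; apply: connect_sub => u v; last first.
    by move=> /hle /connect1.
  rewrite eqh adjacent_perm => /orP[] /andP[] /ct cu /eqP <- //.
  by rewrite symh.
rewrite -eqh /ncomp (eq_n_comp cE) verticesM.
have [eij|ij] := eqVneq i j; last first.
  rewrite addn0; apply: eq_n_comp_r => u; rewrite in_setU.
  rewrite [u \in vertices (ucm _)]mem_vertices outdegU indegU !lt0b.
  (* For [i != j], the edges of the cycle entering [j] and leaving [i] are not the added one, so
     they lie in [h]. *)
  apply/orb_idr => /orP[] /eqP <-; rewrite inE; apply/existsP.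
    exists ((t^-1)%g j); rewrite -{2}[j](permKV t); apply: step.
      by apply: contraNneq ij => jt; rewrite -tj -{1}jt permKV.
    by rewrite -(perm_closed _ tT) permKV.
  exists (t i); rewrite /adjacent orbC; exact: step.
have iV : i \notin vertices h.
  have [_ /(_ i)[oi o1]] := pp; move: oi o1.
  rewrite outdegM indegM outdegU indegU eij eqxx mem_vertices => /addIn <-.
  by rewrite orbb addn1 ltnS leqn0 => /eqP ->.
have iU : i \in vertices h :|: vertices (ucm (j, i)).
  by rewrite in_setU !mem_vertices outdegU eij eqxx !orbT.
(* Components are counted by roots: [i], fixed by [t], is its own root, and the other roots are
   those in [vertices h]. *)
rewrite addn1 /n_comp_mem (cardD1 i) -[RHS]add1n; congr (_ + _)%N.
  rewrite [_ \in _]andbC /= iU; apply/eqP; rewrite eqb1.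
  change (fingraph.root (adjacent h) i == i).
  have := connect_root (adjacent h) i; rewrite -cE eqh connect_adjacent_perm //.
  rewrite eij => /iter_findex <-; rewrite eij in tj.
  by elim: (findex _ _ _) => [|n /eqP e]; rewrite /= ?e ?tj eqxx.
apply: eq_card => u; rewrite !inE; have [->|ui] /= := eqVneq u i.
  by move: iV; rewrite inE => /negPf ->; rewrite andbF.
congr (_ && _); apply/orb_idr => /existsP[v]; rewrite /adjacent !cmU !xpair_eqE.
by rewrite eij eq_sym in ui; rewrite !lt0b eij (negPf ui) andbF.
Qed.
End Cycles.

(** Ensures that no two terms of the expanded determinant share a monomial. *)
Lemma perm_monom_inj N (T T' : {set 'I_N}) t t' :
  perm_on T t -> perm_on T' t' ->
  perm_monom T t = perm_monom T' t' -> T = T' /\ t = t'.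
Proof.
move=> tT tT' e.
have eT : T = T'.
  rewrite -(vertices_perm (perm_on_homo tT)) e vertices_perm //.
  exact: perm_on_homo.
split=> //; apply/permP => k; case: (boolP (k \in T)) => kT; last first.
  by rewrite !(@out_perm _ _ _ k _ kT) // eT.
have := perm_monomE T t k (t k).
by rewrite e perm_monomE -eT kT eqxx; case: eqP.
Qed.

(** The truncated geometric series replaces the inverse of [1 - W]: the adjugate multiplies
    [(1 - W) S = 1 - W ^+ L] on the left. *)
Lemma adj_geometric (A : comPzRingType) n (W : 'M[A]_n) L i j :
  \adj (1%:M - W) i j - (\adj (1%:M - W) *m W ^+ L) i j =
  \det (1%:M - W) * (\sum_(k < L) W ^+ k) i j.
Proof.
set S := \sum_(k < L) _.
have WS : (1%:M - W) *m S = 1%:M - W ^+ L.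
  have := subrX1 W L; rewrite -/S => /(congr1 -%R).
  by rewrite -mulNr !opprB => ->.
have := congr1 (fun B => (\adj (1%:M - W) *m B) i j) WS.
rewrite mulmxA mul_adj_mx mul_scalar_mx mulmxBr mulmx1.
rewrite [X in X = _]mxE => ->.
by rewrite [RHS]mxE; congr (_ + _); rewrite [RHS]mxE.
Qed.

Lemma partial_perm_loop N (E : rel 'I_N) j h :
  partial_perm E (mmul h (ucm (j, j))) -> j \notin vertices h.
Proof.
case=> _ /(_ j); rewrite outdegM indegM outdegU indegU eqxx mem_vertices.
by case=> /addIn <-; rewrite orbb addn1 ltnS leqn0 => /eqP ->.
Qed.

(** * Coefficients of the determinant, of the adjugate and of matrix powers *)

Section Coefficients.
Variables (R : realType) (N : nat).
Implicit Types (E : rel 'I_N) (i j : 'I_N) (d h : monom N).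
Local Notation poly := {malg R[monom N]}.

Lemma mu_perm E (T : {set 'I_N}) t : perm_on T t ->
  {in T, forall k, E k (t k)} ->
  mu E R (perm_monom T t) = (-1) ^+ t * (-1) ^+ #|T|.
Proof.
move=> tT ET; rewrite sign_perm_monom // /mu asboolT //.
exact: (perm_self_avoiding_closed (perm_on_homo tT)).
Qed.

Lemma mu_eq0 E d : ~ partial_perm E d -> mu E R d = 0.
Proof. by move=> npp; rewrite /mu asboolF // => /self_avoiding_closedP. Qed.

(** Unifies the two cases of [mu_ij]. For [i != j] the number of components is unchanged and the
    outer sign is the extra [-1]; for [i = j] the loop adds a component, whose sign cancels the
    outer one. *)
Lemma mu_ij_add_edge E i j h :
  mu_ij E R i j h = - mu (add_edge E j i) R (mmul h (ucm (j, i))).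
Proof.
rewrite /mu_ij /mu.
have -> : `[< self_avoiding_closed (add_edge E j i) (mmul h (ucm (j, i))) >] =
          `[< partial_perm (add_edge E j i) (mmul h (ucm (j, i))) >].
  by apply: asbool_equiv_eq; apply: self_avoiding_closedP.
have [->|ij] := eqVneq i j; last first.
  rewrite (asbool_equiv_eq (self_avoiding_from_toP E h ij)).
  case: asboolP => [pp|_] /=; last by rewrite oppr0.
  by rewrite (ncomp_add_edge pp) (negPf ij) addn0 exprS mulN1r.
have -> : `[< self_avoiding_closed E h >] && (j \notin vertices h) =
          `[< partial_perm (add_edge E j j) (mmul h (ucm (j, j))) >].
  apply/andP/asboolP => [[/asboolP/self_avoiding_closedP pp jV]|pp].
    apply: partial_permM (partial_permS (@subrel_add_edge _ E j j) pp) _ _.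
      split=> u; last by rewrite outdegU indegU leq_b1.
      move=> v; rewrite cmU lt0b xpair_eqE => /andP[/eqP <- /eqP <-].
      by rewrite /add_edge !eqxx orbT.
    rewrite disjoint_subset; apply/subsetP => u uV.
    rewrite inE /= mem_vertices outdegU indegU orbb lt0b.
    by apply: contraNneq jV => ->.
  have jV := partial_perm_loop pp; split=> //.
  apply/asboolP/self_avoiding_closedP.
  case: pp => ppE ppd; split=> u.
    (* [h] does not cross [j], so none of its edges is the added loop. *)
    move=> v huv.
    have: add_edge E j j u v by apply: ppE; rewrite cmM addn_gt0 huv.
    rewrite /add_edge; case: (eqVneq u j) => [uj|_]; last by rewrite orbF.
    have := leq_trans huv (leq_outdeg h u v).
    by move: jV; rewrite mem_vertices negb_or -uj => /andP[/negPf ->].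
  have := ppd u; rewrite outdegM indegM outdegU indegU => -[/addIn -> h1].
  by split=> //; apply: leq_trans h1; apply: leq_addr.
rewrite /=; case: asboolP => [pp|_] /=; last by rewrite oppr0.
by rewrite (ncomp_add_edge pp) eqxx addn1 exprS mulN1r opprK.
Qed.

Definition adjm E : 'M[poly]_N :=
  \matrix_(u, v) if E u v then << ucm (u, v) >> else 0.

Definition sub1_adjm E : 'M[poly]_N :=
  \matrix_(u, v) ((u == v)%:R - if E u v then << ucm (u, v) >> else 0).

Lemma sub1_adjmE E : sub1_adjm E = 1%:M - adjm E.
Proof. by apply/matrixP => u v; rewrite !mxE. Qed.

Lemma malgUM (c d : monom N) : << mmul c d >> = << c >> * << d >> :> poly.
Proof. by rewrite malgM_def fgmulUU mulr1. Qed.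

(* [mcoeff] with its algebraic structures fixed once and for all: unifying the
   different paths to the zmodule structure of a [realType] is very slow. *)
Definition coef d (g : poly) : R := g@_d.

Lemma coefB d (g g' : poly) : coef d (g - g') = coef d g - coef d g'.
Proof. exact: mcoeffB. Qed.

Lemma coef_sum d (I : Type) (r : seq I) (P : pred I) (F : I -> poly) :
  coef d (\sum_(k <- r | P k) F k) = \sum_(k <- r | P k) coef d (F k).
Proof. exact: raddf_sum. Qed.

Lemma coef_signM n (g : poly) d : coef d ((-1) ^+ n * g) = (-1) ^+ n * coef d g.
Proof.
rewrite /coef -signr_odd -[in RHS]signr_odd.
by case: odd; rewrite ?mulN1r ?mcoeffN // !mul1r.
Qed.

Lemma coefU c d : coef d << c >> = (c == d)%:R.
Proof. exact: mcoeffU1. Qed.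

(** Each product of the Leibniz formula is distributed: [T] collects the rows where the entry of
    [- W] is chosen, and the identity entries of the other rows force [t] to fix them. *)
Lemma det_adjm E : \det (sub1_adjm E) =
  \sum_(t : {perm 'I_N})
    \sum_(T : {set 'I_N} | perm_on T t && [forall k in T, E k (t k)])
      (-1) ^+ t * ((-1) ^+ #|T| * << perm_monom T t >>).
Proof.
apply: eq_bigr => t _; rewrite -mulr_sumr; congr (_ * _).
transitivity (\prod_k (- (if E k (t k) then << ucm (k, t k) >> else 0)
                       + (k == t k)%:R : poly)).
  by apply: eq_bigr => k _; rewrite mxE addrC.
rewrite bigA_distr [RHS]big_mkcond.
apply: eq_big => [T|T _]; first by rewrite inE.
case: ifPn => [/andP[tT /forall_inP ET]|].
  rewrite (bigID (mem T)) /= -[RHS]mulr1; congr (_ * _); last first.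
    by apply: big1 => k kT; rewrite (negPf kT) (out_perm tT kT) eqxx.
  transitivity (\prod_(k in T) - (<< ucm (k, t k) >> : poly)).
    by apply: eq_bigr => k kT; rewrite kT ET.
  rewrite prodrN; congr (_ * _); apply/esym.
  apply: (big_morph (fun c : monom N => << c >> : poly)) => // c d.
  exact: malgUM.
rewrite negb_and => /orP[/subsetPn[k]|/forall_inPn[k kT /negPf nE]].
  rewrite inE => /negPf tk kT; rewrite (bigD1 k) //= (negPf kT) eq_sym tk.
  by rewrite mul0r.
by rewrite (bigD1 k) //= kT nE oppr0 mul0r.
Qed.

Lemma coef_det_adjm E d : coef d (\det (sub1_adjm E)) = mu E R d.
Proof.
rewrite det_adjm coef_sum.
transitivity (\sum_(t : {perm 'I_N})
  \sum_(T : {set 'I_N} | perm_on T t && [forall k in T, E k (t k)])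
     (-1) ^+ t * ((-1) ^+ #|T| * (perm_monom T t == d)%:R) : R).
  apply: eq_bigr => t _; rewrite coef_sum; apply: eq_bigr => T _.
  by rewrite !coef_signM coefU.
have [/partial_permP[T [t [tT ET ->]]]|npp] := pselect (partial_perm E d).
  have ET' : perm_on T t && [forall k in T, E k (t k)].
    by rewrite tT; apply/forall_inP.
  rewrite mu_perm //.
  (* By [perm_monom_inj], the pair of [t] and [T] is the only one that contributes. *)
  rewrite (eq_bigr (fun t' =>
    if t' == t then (-1) ^+ t * (-1) ^+ #|T| else 0)).
    by rewrite -big_mkcond big_pred1_eq.
  move=> t' _; have [->|tt'] := eqVneq t' t.
    rewrite (bigD1 T ET') eqxx mulr1 big1 => [|T' /andP[/andP[tT' _] TT']].
      exact: addr0.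
    case: eqP => [|_]; last by rewrite !mulr0.
    by case/(perm_monom_inj tT' tT) => e; rewrite e eqxx in TT'.
  apply: big1 => T' /andP[tT' _]; case: eqP => [|_]; last by rewrite !mulr0.
  by case/(perm_monom_inj tT' tT) => _ e; rewrite e eqxx in tt'.
rewrite mu_eq0 // big1 // => t _; rewrite big1 // => T /andP[tT /forall_inP ET].
case: eqP; rewrite ?mulr0 // => e; case: npp; rewrite -e.
exact: (partial_perm_perm (perm_on_homo tT)).
Qed.

(** [divcm] subtracts exponents with truncation, so multiplying back tests whether [d] divides
    [h]. *)
Lemma coefM_dvd (a b : poly) h : coef h (a * b) =
  \sum_(d <- msupp a)
     if mmul d (divcm h d) == h then coef d a * coef (divcm h d) b else 0.
Proof.
rewrite /coef mcoeffMl; apply: eq_bigr => d _.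
have div k : (mmul d k == h) = (mmul d (divcm h d) == h) && (k == divcm h d).
  apply/eqP/andP => [<-|[/eqP dh /eqP -> //]].
  have -> : divcm (mmul d k) d = k.
    by apply/eqP/cmP => e; rewrite divcmE cmM addKn.
  by rewrite !eqxx.
under eq_bigr => k _ do rewrite div.
case: ifP => _ /=; last by rewrite big1 // => k _; rewrite mulr0n.
have [bd|bd] := boolP (divcm h d \in msupp b); last first.
  rewrite (mcoeff_outdom bd) mulr0 big1_seq // => k /= kb.
  by case: eqP => // e; rewrite -e kb in bd.
rewrite (bigD1_seq (divcm h d)) ?fset_uniq //= eqxx mulr1n.
by rewrite big1 ?addr0 // => k /negPf ->.
Qed.

Lemma coefMU (a : poly) c h : (forall d, mmul d c = mmul h c -> d = h) ->
  coef (mmul h c) (a * << c >>) = coef h a.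
Proof.
move=> injc; rewrite /coef malgM_def fgmulgU [in RHS](monalgE a) !raddf_sum /=.
apply: eq_bigr => d _; rewrite mulr1 !mcoeffU; congr (_ *+ nat_of_bool _).
by apply/eqP/eqP => [/injc|->].
Qed.

(** Whether or not [(j, i)] is in [E], the graphs [E0] without it and [E1] with it have the
    cofactors of [E] along row [j]. Expanding along this row, their determinants differ by the
    cofactor times omega_ji. *)
Lemma coef_adj_adjm E i j h :
  coef h (\adj (sub1_adjm E) i j) = mu_ij E R i j h.
Proof.
rewrite mu_ij_add_edge mxE; set E1 := add_edge E j i.
pose E0 u v := E u v && ~~ ((u == j) && (v == i)).
have cof F l : (forall u v, u != j -> F u v = E u v) ->
    cofactor (sub1_adjm F) j l = cofactor (sub1_adjm E) j l.
  move=> FE.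
  have e : row' j (col' l (sub1_adjm F)) = row' j (col' l (sub1_adjm E)).
    by apply/matrixP => u v; rewrite !mxE FE // eq_sym neq_lift.
  by rewrite /cofactor e.
have E0E u v : u != j -> E0 u v = E u v.
  by move=> /negPf uj; rewrite /E0 uj andbT.
have E1E u v : u != j -> E1 u v = E u v.
  by move=> /negPf uj; rewrite /E1 /add_edge uj orbF.
have : cofactor (sub1_adjm E) j i * << ucm (j, i) >> =
       \det (sub1_adjm E0) - \det (sub1_adjm E1).
  rewrite !(expand_det_row _ j) -sumrB (bigD1 i) //= big1 ?addr0 => [|l li].
    rewrite !cof // -mulrBl mulrC; congr (_ * _).
    rewrite !mxE /E0 /E1 /add_edge !eqxx andbF orbT oppr0 addr0.
    by rewrite opprB addrC subrK.
  have -> : sub1_adjm E0 j l = sub1_adjm E1 j l.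
    by rewrite !mxE /E0 /E1 /add_edge (negPf li) !andbF andbT orbF.
  by rewrite !cof // subrr.
move/(congr1 (coef (mmul h (ucm (j, i))))).
rewrite coefMU => [->|d]; last exact: mmul_ucm_inj.
have D0 := coef_det_adjm E0 (mmul h (ucm (j, i))).
have D1 := coef_det_adjm E1 (mmul h (ucm (j, i))).
rewrite coefB.
apply: etrans (congr2 (fun x y : R => x - y) D0 D1) _.
(* The monomial contains omega_ji, which is not an edge of [E0]. *)
rewrite (_ : mu E0 R _ = 0); first exact: sub0r.
apply: mu_eq0 => -[/(_ j i)].
by rewrite cmM cmUU addn1 /E0 !eqxx andbF => /(_ isT).
Qed.

Lemma adjmX E k i j : (adjm E ^+ k) i j =
  \sum_(s : k.-tuple 'I_N | is_walk E i j s) << walk_monom i s >>.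
Proof.
elim: k i => [|k IHk] i.
  rewrite expr0 mxE /is_walk; have [->|ij] := eqVneq i j.
    rewrite (big_pred1 [tuple]) ?walk_monom_nil // => s.
    by rewrite [s]tuple0 /= !eqxx.
  by rewrite big1 // => s; rewrite [s]tuple0 /= (negPf ij).
rewrite exprS mxE.
transitivity (\sum_(x : 'I_N)
    \sum_(s : k.-tuple 'I_N | E i x && is_walk E x j s)
      (<< walk_monom i (x :: s) >> : poly)).
  apply: eq_bigr => x _; rewrite IHk mxE.
  case: (E i x) => /=; last by rewrite mul0r big_pred0.
  rewrite mulr_sumr; apply: eq_bigr => s _.
  by rewrite walk_monom_cons malgUM.
rewrite pair_big_dep /=.
rewrite [RHS](reindex (fun p : 'I_N * k.-tuple 'I_N =>
  [tuple of p.1 :: p.2])) /=.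
  by apply: eq_bigl => p; rewrite /is_walk /= andbA.
exists (fun s => (thead s, [tuple of behead s])) => [[x s] _ | s _] /=.
  by congr pair; apply/val_inj.
by rewrite [RHS]tuple_eta.
Qed.

Lemma coef_adjmX E k i j d : coef d ((adjm E ^+ k) i j) =
  #|[pred s : k.-tuple 'I_N | is_walk E i j s & walk_monom i s == d]|%:R.
Proof.
rewrite adjmX coef_sum -sum1_card natr_sum.
rewrite [RHS](eq_bigl (fun s : k.-tuple 'I_N =>
  is_walk E i j s && (walk_monom i s == d))); last by move=> s; rewrite inE.
rewrite [RHS]big_mkcondr /=; apply: eq_bigr => s _.
by rewrite coefU; case: eqP.
Qed.

Lemma coef_adjmX_deg E k i j d : k != mdeg d -> coef d ((adjm E ^+ k) i j) = 0.
Proof.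
move=> kd; rewrite coef_adjmX eq_card0 // => s; rewrite !inE.
apply/negP => /andP[_ /eqP e].
by move: kd; rewrite -e mdeg_walk size_tuple eqxx.
Qed.

(** Entries of [adjm E ^+ k] are homogeneous of degree [k], so only [k = mdeg d] contributes. *)
Lemma coef_sum_adjmX E L i j d : (mdeg d < L)%N ->
  coef d ((\sum_(k < L) adjm E ^+ k) i j) = f_ij E R i j d.
Proof.
move=> dL; rewrite summxE coef_sum (bigD1 (Ordinal dL)) //= big1 ?addr0.
  by rewrite coef_adjmX.
move=> k kd; apply: coef_adjmX_deg.
by apply: contra kd => /eqP e; apply/eqP/val_inj.
Qed.

Lemma mu_ij_sum E i j h : mu_ij E R i j h =
  \sum_(d <- msupp (\det (sub1_adjm E)))
    if mmul d (divcm h d) == h then mu E R d * f_ij E R i j (divcm h d) else 0.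
Proof.
have deg_div d : mmul d (divcm h d) == h ->
    (mdeg (divcm h d) < (mdeg h).+1)%N.
  by move=> /eqP e; rewrite ltnS -{2}e mdegM leq_addl.
(* With this exponent, [W ^+ L] has too large a degree to contribute to the coefficient of [h]. *)
have := congr1 (coef h) (adj_geometric (adjm E) (mdeg h).+1 i j).
rewrite -sub1_adjmE.
rewrite coefB coef_adj_adjm coefM_dvd mxE coef_sum big1 ?subr0.
  move=> ->; apply: eq_bigr => d _; case: ifP => // /deg_div dh.
  by rewrite coef_det_adjm coef_sum_adjmX.
move=> l _; rewrite coefM_dvd big1 // => d _; case: ifP => // /deg_div dh.
by rewrite coef_adjmX_deg ?mulr0 // neq_ltn dh orbT.
Qed.

End Coefficients.

(** * Loop erasure and the sum over closed divisors *)

(** Loops are erased from the end of the walk backwards: when the new first vertex [i] recurs in the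
    erased tail, the part up to it is a simple cycle. For [i = j], uniqueness of [i :: s'] forces
    [s'] to be empty. *)
Lemma walk_uniq_decomposition N (E : rel 'I_N) i j s : is_walk E i j s ->
  exists s' cs, [/\ is_walk E i j s', uniq (i :: s'),
    (forall c, c \in cs -> simple_cycle E c) &
    walk_monom i s = mmul (walk_monom i s') (monom_prod cs)].
Proof.
elim: s i => [|x s IHs] i.
  move=> w; exists [::], [::]; split=> //.
  by rewrite /monom_prod big_nil mulm1.
case/andP=> /= /andP[Eix px] lx.
have [|s' [cs [/andP[px' lx'] ux' csE eqs]]] := IHs x; first exact/andP.
rewrite walk_monom_cons {}eqs mulmA -walk_monom_cons.
have [ixs|ixs] := boolP (i \in x :: s'); last first.
  exists (x :: s'), cs; split=> //; last by rewrite cons_uniq ixs.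
  by rewrite /is_walk /= Eix px'.
have : path E i (x :: s') by rewrite /= Eix.
have : last i (x :: s') == j by [].
(* [rcons p1 i] is the cycle to erase and [p2] the remaining walk from [i]. *)
case/path.splitP: ixs ux' => p1 p2; rewrite cat_uniq rcons_uniq.
rewrite last_cat last_rcons cat_path last_rcons.
case/and3P=> /andP[ip1 up1] /hasPn p12 up2 lp /andP[pp1 pp2].
exists p2, (walk_monom i (rcons p1 i) :: cs); split=> //.
- by rewrite /is_walk pp2.
- rewrite /= up2 andbT; apply/negP => /p12.
  by rewrite mem_rcons mem_head.
- move=> c; rewrite inE => /predU1P[->|/csE //].
  exists i, (rcons p1 i); split=> //; first by case: (p1).
  by rewrite /is_simple_walk /is_walk pp1 last_rcons !eqxx rcons_uniq ip1.
- rewrite walk_monom_cat last_rcons /monom_prod big_cons mulmA.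
  by congr mmul; apply: mulmC.
Qed.

Lemma walk_hike N (E : rel 'I_N) i j s :
  is_walk E i j s -> hike E (walk_monom i s).
Proof.
case/walk_uniq_decomposition => s' [cs [ws us csE ->]].
exists i, j, (walk_monom i s'), cs; split=> //; exists s' => //.
by rewrite /is_simple_walk ws us; move: us => /= /andP[_ ->]; rewrite if_same.
Qed.

Lemma f_ij_hike (R : realType) N (E : rel 'I_N) i j h :
  f_ij E R i j h != 0 -> hike E h.
Proof.
rewrite /f_ij; case: (pickP [pred s : (mdeg h).-tuple 'I_N |
    is_walk E i j s & walk_monom i s == h]) => [s /andP[ws /eqP <-] _|].
  exact: walk_hike ws.
by move=> /eq_card0 ->; rewrite eqxx.
Qed.

Lemma mu_closed_hike (R : realType) N (E : rel 'I_N) d :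
  mu E R d != 0 -> closed_hike E d.
Proof.
rewrite /mu; case: asboolP => [[cs [csE _ ->]] _|_]; last by rewrite eqxx.
by exists cs.
Qed.

Theorem theorem1 (R : realType) (N : nat) (E : rel 'I_N) (i j : 'I_N)
    (h : monom N) (hh : hike E h) :
  mu_ij E R i j h =
    \sum_(d \in closed_divisors E h) mu E R d * f_ij E R i j (divcm h d).
Proof.
(* Both sums are extended by zero to all monomials; outside the support of the determinant, [mu]
   vanishes as its coefficient. *)
rewrite mu_ij_sum fsbig_mkcond -fsbigTE => [|d].
  apply: eq_fsbigr => d _; rewrite /patch.
  have [dvd|ndvd] := boolP (d \in closed_divisors E h).
    have [_ [h' _ ->]] := set_mem dvd.
    have -> : divcm (mmul d h') d = h'.
      by apply/eqP/cmP => e; rewrite divcmE cmM addKn.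
    by rewrite eqxx.
  case: eqP => // dh.
  (* A nonzero term would make [d] a closed hike and, by loop erasure, the quotient a hike, so [d]
     would be a closed divisor. *)
  apply/eqP; rewrite mulf_eq0; apply: contraNT ndvd.
  rewrite negb_or => /andP[/mu_closed_hike cd /f_ij_hike hd].
  apply/mem_set; split=> //.
  by exists (divcm h d).
by move=> /mcoeff_outdom dE; rewrite -coef_det_adjm /coef dE mul0r if_same.
Qed.
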